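(* Let $k$ be a field, let $\bar c\in k$ be a square, and let $\bar d\in k$ with $\bar d\notin k^{\times 2}$. Then $$C=\{(x,y)\in k^2 \mid x^2+\bar c\,y^2-1-\bar d\,x^2y^2=0\}$$ is an abelian group with binary operation $$(x_1,y_1)\oplus_0(x_2,y_2)=\left(\frac{x_1x_2-\bar c\,y_1y_2}{1-\bar d\,x_1x_2y_1y_2},\ \frac{x_1y_2+y_1x_2}{1+\bar d\,x_1x_2y_1y_2}\right).$$
   Context: $k^{\times 2}$ denotes the set of squares of nonzero elements of $k$; in particular $\bar d=0$ is allowed. The field $k$ is arbitrary. The assertion includes that the denominators in the formula for $\oplus_0$ are nonzero for all pairs of points of $C$ and that $C$ is closed under $\oplus_0$. The identity element is $(1,0)$ and the inverse of $(x,y)$ is $(x,-y)$. *)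

(* Defs.v *)
From HB Require Import structures.
From mathcomp Require Import all_boot all_order all_algebra.

Set Implicit Arguments.
Unset Strict Implicit.
Unset Printing Implicit Defensive.

Import GRing.Theory.
Local Open Scope ring_scope.

Definition is_square (k : fieldType) (a : k) : Prop :=
  exists z : k, a = z ^+ 2.

(* Zero is excluded: it is the square of no nonzero element. *)
Definition is_nonzero_square (k : fieldType) (a : k) : Prop :=
  exists2 z : k, z != 0 & a = z ^+ 2.

Definition edwards_curve (k : fieldType) (c d : k) : pred (k * k) :=
  fun P => let: (x, y) := P in
    x ^+ 2 + c * y ^+ 2 - 1 - d * x ^+ 2 * y ^+ 2 == 0.

Definition edwards_point (k : fieldType) (c d : k) : Type :=
  {P : k * k | edwards_curve c d P}.

Definition edwards_denom_l (k : fieldType) (d : k) (P1 P2 : k * k) : k :=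
  let: (x1, y1) := P1 in let: (x2, y2) := P2 in
  1 - d * x1 * x2 * y1 * y2.

Definition edwards_denom_r (k : fieldType) (d : k) (P1 P2 : k * k) : k :=
  let: (x1, y1) := P1 in let: (x2, y2) := P2 in
  1 + d * x1 * x2 * y1 * y2.

(* Total on k * k only because division by zero returns zero. *)
Definition edwards_add (k : fieldType) (c d : k) (P1 P2 : k * k) : k * k :=
  let: (x1, y1) := P1 in let: (x2, y2) := P2 in
  ((x1 * x2 - c * y1 * y2) / edwards_denom_l d P1 P2,
   (x1 * y2 + y1 * x2) / edwards_denom_r d P1 P2).

Definition edwards_opp (k : fieldType) (P : k * k) : k * k :=
  let: (x, y) := P in (x, - y).

(* Main.v *)
Require Import Defs.
From HB Require Import structures.
From mathcomp Require Import all_boot all_order all_algebra.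
From mathcomp Require Import ring.

(** The denominators are [1 - e] and [1 + e] with [e = d x1 x2 y1 y2], so one of
    them vanishes only if [e ^ 2 = 1].  Write [c = z ^ 2].  If [e ^ 2 = 1], the
    two curve equations give, for either choice of the square root [z],
      [(x1 + e z y1) ^ 2 = d (x1 y1 (x2 + z y2)) ^ 2],
    which exhibits [d] as a nonzero square as soon as [x2 + z y2] or
    [x2 - z y2] is nonzero.  If both are zero the characteristic is two, and the
    second curve equation then reads [d (x2 y2) ^ 2 = 1].  This is
    [edwards_product_sqr_neq1].

    With nonzero denominators, closure and associativity become polynomial
    identities modulo the curve equations ([closure_identity] and
    [assoc_identity]).  Checking them by expansion needs a normal form for
    polynomials on the curve.  If [d = 0] the curve is the conic
    [x ^ 2 = 1 - c y ^ 2], and this is a rewrite rule.  If [d != 0], put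
    [t = 1 / d]; the curve equation factors as
      [(x ^ 2 - c t) (t - y ^ 2) = t (1 - c t)],
    and [s = t - y ^ 2] is nonzero because [d] is not a nonzero square.
    With [r = 1 / s] the curve is described by the rewrite rules
      [y ^ 2 = t - s],  [x ^ 2 = t (1 - c t) r + c t],  [r s = 1],  [d t = 1].
    Their left-hand sides, for any number of points, are pairwise coprime
    monomials, so the rules form a Groebner basis, and rewriting with them
    followed by expansion decides whether an identity follows from them.

    Addition is visibly commutative, so associativity amounts to the invariance
    of [(P1 + P2) + P3] under cyclic permutation of the three points; hence a
    single formula for the triple sum, [edwards_add3E], suffices. *)

Set Implicit Arguments.
Unset Strict Implicit.
Unset Printing Implicit Defensive.

Import GRing.Theory.
Local Open Scope ring_scope.

(** * Nonvanishing of the denominators *)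

Lemma nonsquare_mul_sqr_neq (k : fieldType) (d a b : k) :
  ~ is_nonzero_square d -> d != 0 -> b != 0 -> d * b ^+ 2 != a ^+ 2.
Proof.
move=> hd d0 b0; apply/eqP => E; apply: hd.
have dE : d = (a / b) ^+ 2 by rewrite expr_div_n -E mulfK // expf_neq0.
by exists (a / b) => //; apply: contraNneq d0 => ab0; rewrite dE ab0 expr0n.
Qed.

(** The square root of [c] turns [x ^ 2 + c y ^ 2] into the square of
    [x + w y] up to a cross term, for [w] either root.  The cross terms match
    when the product is [1] or [-1], which makes [d] a quotient of two squares;
    both roots are needed because [x2 + w y2] may vanish for one of them. *)
Lemma edwards_product_sqr_neq1 (k : fieldType) (c d x1 y1 x2 y2 : k) :
  is_square c -> ~ is_nonzero_square d ->
  edwards_curve c d (x1, y1) -> edwards_curve c d (x2, y2) ->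
  (d * x1 * x2 * y1 * y2) ^+ 2 != 1.
Proof.
move=> [z ->] hd /eqP C1 /eqP C2; apply/eqP => E.
have : d * x1 * x2 * y1 * y2 != 0.
  by apply/eqP => e0; move/eqP: E; rewrite e0 expr0n eq_sym oner_eq0.
rewrite !mulf_eq0 !negb_or => /andP[/andP[/andP[/andP[d0 x10] x20] y10] y20].
have vanish w : w ^+ 2 = z ^+ 2 -> x2 + w * y2 = 0.
  move=> wz; apply/eqP; apply: contraT => b0.
  have /eqP[] := nonsquare_mul_sqr_neq
    (x1 + (d * x1 * x2 * y1 * y2) * w * y1) hd d0
    (mulf_neq0 (mulf_neq0 x10 y10) b0).
  move: C1 C2 E; rewrite -!wz => C1 C2 E.
  apply/eqP; rewrite -subr_eq0; apply/eqP.
  (* The cross terms in [w] agree identically; the rest is a combination of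
     the two curve equations and [e ^ 2 = 1]. *)
  transitivity (d * x1 ^+ 2 * y1 ^+ 2
      * (x2 ^+ 2 + w ^+ 2 * y2 ^+ 2 - 1 - d * x2 ^+ 2 * y2 ^+ 2)
    + (1 - w ^+ 2 * y1 ^+ 2) * ((d * x1 * x2 * y1 * y2) ^+ 2 - 1)
    - (x1 ^+ 2 + w ^+ 2 * y1 ^+ 2 - 1 - d * x1 ^+ 2 * y1 ^+ 2)).
    by ring.
  by rewrite C1 C2 E; ring.
have xz := vanish z erefl; have xNz := vanish (- z) (sqrrN z).
(* Adding the two relations leaves [2 x2 = 0], so the characteristic is two. *)
have two0 : (2 : k) = 0.
  apply: (mulfI x20); rewrite mulr0.
  transitivity ((x2 + z * y2) + (x2 + - z * y2)); first by ring.
  by rewrite xz xNz addr0.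
have /eqP[] := nonsquare_mul_sqr_neq 1 hd d0 (mulf_neq0 x20 y20).
transitivity ((x2 + z * y2) ^+ 2 + 1 - 2 * (1 + x2 * z * y2)
  - (x2 ^+ 2 + z ^+ 2 * y2 ^+ 2 - 1 - d * x2 ^+ 2 * y2 ^+ 2)); first by ring.
by rewrite C2 xz two0; ring.
Qed.

Lemma edwards_denoms_neq0 (k : fieldType) (c d : k) (P1 P2 : k * k) :
  is_square c -> ~ is_nonzero_square d ->
  edwards_curve c d P1 -> edwards_curve c d P2 ->
  edwards_denom_l d P1 P2 != 0 /\ edwards_denom_r d P1 P2 != 0.
Proof.
case: P1 P2 => [x1 y1] [x2 y2] hc hd C1 C2.
have := edwards_product_sqr_neq1 hc hd C1 C2; rewrite /=.
set e := d * x1 * x2 * y1 * y2 => e2; split; apply: contraNneq e2 => E.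
  by move/eqP: E; rewrite subr_eq0 => /eqP <-; rewrite expr1n.
by move/eqP: E; rewrite addr_eq0 -sqrrN => /eqP <-; rewrite expr1n.
Qed.

(** * The polynomial identities on the curve *)

(** For [d != 0] the curve equation is
    [(x ^ 2 - c / d) (1 / d - y ^ 2) = (1 - c / d) / d]; here [t] is [1 / d],
    [s] is the second factor and [r] its inverse, which exists because [y] is not
    a square root of [1 / d]. *)
Lemma edwards_curve_param (k : fieldType) (c d t x y : k) :
  ~ is_nonzero_square d -> d * t = 1 -> edwards_curve c d (x, y) ->
  exists r s, [/\ r * s = 1, y ^+ 2 = t - s &
                  x ^+ 2 = t * (1 - c * t) * r + c * t].
Proof.
move=> hd dt /eqP Cxy.
have d0 : d != 0 by apply: contra_eq_neq dt => ->; rewrite mul0r eq_sym oner_eq0.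
have s0 : t - y ^+ 2 != 0.
  apply/eqP => /eqP; rewrite subr_eq0 => /eqP tE.
  have y0 : y != 0.
    by apply: contra_eq_neq dt => y0; rewrite tE y0 expr0n mulr0 eq_sym oner_eq0.
  by move/eqP: (nonsquare_mul_sqr_neq 1 hd d0 y0); rewrite -tE dt expr1n.
exists (t - y ^+ 2)^-1, (t - y ^+ 2); split; [exact: mulVf | by ring |].
apply: (mulIf s0); rewrite mulrDl mulfVK //.
apply/eqP; rewrite -subr_eq0; apply/eqP.
transitivity (t * (x ^+ 2 + c * y ^+ 2 - 1 - d * x ^+ 2 * y ^+ 2)
  + x ^+ 2 * y ^+ 2 * (d * t - 1)); first by ring.
by rewrite Cxy dt; ring.
Qed.

Lemma edwards_curve_conic (k : fieldType) (c x y : k) :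
  edwards_curve c 0 (x, y) -> x ^+ 2 = 1 - c * y ^+ 2.
Proof.
by move=> /eqP E; apply/eqP; rewrite -subr_eq0 -E; apply/eqP; ring.
Qed.

(** The curve equation of the sum, cleared of its denominators. *)
Lemma closure_identity (k : fieldType) (c d x1 y1 x2 y2 : k) :
  ~ is_nonzero_square d ->
  edwards_curve c d (x1, y1) -> edwards_curve c d (x2, y2) ->
  let p := x1 * x2 - c * y1 * y2 in
  let q := x1 * y2 + y1 * x2 in
  let l := edwards_denom_l d (x1, y1) (x2, y2) in
  let r := edwards_denom_r d (x1, y1) (x2, y2) in
  p ^+ 2 * r ^+ 2 + c * q ^+ 2 * l ^+ 2
    = l ^+ 2 * r ^+ 2 + d * p ^+ 2 * q ^+ 2.
Proof.
move=> hd C1 C2; rewrite /edwards_denom_l /edwards_denom_r /=.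
have [d0|d0] := eqVneq d 0.
  rewrite d0 in C1 C2 *.
  by ring: (edwards_curve_conic C1) (edwards_curve_conic C2).
have dt := mulfV d0.
have [r1 [s1 [h1 hy1 hx1]]] := edwards_curve_param hd dt C1.
have [r2 [s2 [h2 hy2 hx2]]] := edwards_curve_param hd dt C2.
move: (d^-1) dt hy1 hx1 hy2 hx2 => t dt hy1 hx1 hy2 hx2.
by ring: dt h1 h2 hy1 hy2 hx1 hx2.
Qed.

(** The numerator and denominator of each coordinate of [(P1 + P2) + P3], after
    multiplication by the two denominators of [P1 + P2]. *)
Section TripleSum.
Variables (k : fieldType) (c d : k).
Implicit Types P : k * k.

Definition triple_num_l P1 P2 P3 : k :=
  (P1.1 * P2.1 - c * P1.2 * P2.2) * edwards_denom_r d P1 P2 * P3.1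
  - c * (P1.1 * P2.2 + P1.2 * P2.1) * edwards_denom_l d P1 P2 * P3.2.

Definition triple_num_r P1 P2 P3 : k :=
  (P1.1 * P2.1 - c * P1.2 * P2.2) * edwards_denom_r d P1 P2 * P3.2
  + (P1.1 * P2.2 + P1.2 * P2.1) * edwards_denom_l d P1 P2 * P3.1.

Definition triple_corr P1 P2 P3 : k :=
  d * (P1.1 * P2.1 - c * P1.2 * P2.2) * (P1.1 * P2.2 + P1.2 * P2.1)
    * P3.1 * P3.2.

Definition triple_denom_l P1 P2 P3 : k :=
  edwards_denom_l d P1 P2 * edwards_denom_r d P1 P2 - triple_corr P1 P2 P3.

Definition triple_denom_r P1 P2 P3 : k :=
  edwards_denom_l d P1 P2 * edwards_denom_r d P1 P2 + triple_corr P1 P2 P3.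

(** Cross-multiplied equality of [(P1 + P2) + P3] and [(P2 + P3) + P1]; in view
    of commutativity this cyclic invariance is associativity. *)
Lemma assoc_identity P1 P2 P3 :
  ~ is_nonzero_square d ->
  edwards_curve c d P1 -> edwards_curve c d P2 -> edwards_curve c d P3 ->
  triple_num_l P1 P2 P3 * triple_denom_l P2 P3 P1
    = triple_num_l P2 P3 P1 * triple_denom_l P1 P2 P3 /\
  triple_num_r P1 P2 P3 * triple_denom_r P2 P3 P1
    = triple_num_r P2 P3 P1 * triple_denom_r P1 P2 P3.
Proof.
case: P1 P2 P3 => [x1 y1] [x2 y2] [x3 y3] hd C1 C2 C3.
rewrite /triple_num_l /triple_num_r /triple_denom_l /triple_denom_r.
rewrite /triple_corr /edwards_denom_l /edwards_denom_r/=.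
have [d0|d0] := eqVneq d 0.
  rewrite d0 in C1 C2 C3 *.
  move: (edwards_curve_conic C1) (edwards_curve_conic C2).
  move: (edwards_curve_conic C3) => E3 E1 E2.
  by split; ring: E1 E2 E3.
have dt := mulfV d0.
have [r1 [s1 [h1 hy1 hx1]]] := edwards_curve_param hd dt C1.
have [r2 [s2 [h2 hy2 hx2]]] := edwards_curve_param hd dt C2.
have [r3 [s3 [h3 hy3 hx3]]] := edwards_curve_param hd dt C3.
move: (d^-1) dt hy1 hx1 hy2 hx2 hy3 hx3 => t dt hy1 hx1 hy2 hx2 hy3 hx3.
by split; ring: dt h1 h2 h3 hy1 hy2 hy3 hx1 hx2 hx3.
Qed.

End TripleSum.

(** * The group law *)

Section GroupLaw.
Variables (k : fieldType) (c d : k).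
Hypotheses (hc : is_square c) (hd : ~ is_nonzero_square d).
Implicit Types P : k * k.

Local Notation add := (edwards_add c d).
Local Notation on_curve := (edwards_curve c d).

Lemma edwards_curve_add P1 P2 :
  on_curve P1 -> on_curve P2 -> on_curve (add P1 P2).
Proof.
move=> C1 C2; have [l0 r0] := edwards_denoms_neq0 hc hd C1 C2.
case: P1 P2 C1 C2 l0 r0 => [x1 y1] [x2 y2] C1 C2.
have := closure_identity hd C1 C2; rewrite /edwards_add /edwards_curve.
move: (edwards_denom_l _ _ _) (edwards_denom_r _ _ _) => l r /= E l0 r0.
have lr0 : l ^+ 2 * r ^+ 2 != 0 by rewrite mulf_neq0 ?expf_neq0.
apply/eqP/(mulIf lr0); rewrite mul0r.
move/eqP: E; rewrite -subr_eq0 => /eqP <-.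
by field; rewrite l0 r0.
Qed.

Lemma edwards_curve_one : on_curve (1, 0).
Proof. by apply/eqP; ring. Qed.

Lemma edwards_curve_opp P : on_curve P -> on_curve (edwards_opp P).
Proof. by case: P => x y; rewrite /= sqrrN. Qed.

Lemma edwards_addC P1 P2 : add P1 P2 = add P2 P1.
Proof.
case: P1 P2 => [x1 y1] [x2 y2]; rewrite /edwards_add /=.
by congr (_ / _, _ / _); ring.
Qed.

Lemma edwards_add1 P : add (1, 0) P = P.
Proof.
case: P => x y; rewrite /edwards_add /= !(mulr0, mul0r, mul1r, addr0, subr0).
by rewrite !divr1.
Qed.

Lemma edwards_addN P : on_curve P -> add (edwards_opp P) P = (1, 0).
Proof.
case: P => x y CP.
have [l0 _] := edwards_denoms_neq0 hc hd (edwards_curve_opp CP) CP.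
rewrite /edwards_add /edwards_opp; congr (_, _).
  (* The numerator and the denominator differ by the curve equation. *)
  rewrite -[RHS](divff l0); congr (_ / _); apply/eqP; rewrite -subr_eq0.
  by move/eqP: CP => <-; apply/eqP; rewrite /edwards_denom_l /=; ring.
by rewrite mulNr [y * x]mulrC subrr mul0r.
Qed.

(** The denominators of the triple sum are nonzero because each is the matching
    denominator of the pair [P1 + P2], [P3], both points of the curve, multiplied
    by the two denominators of [P1 + P2]. *)
Lemma edwards_add3E P1 P2 P3 :
  on_curve P1 -> on_curve P2 -> on_curve P3 ->
  [/\ triple_denom_l c d P1 P2 P3 != 0, triple_denom_r c d P1 P2 P3 != 0 &
      add (add P1 P2) P3
        = (triple_num_l c d P1 P2 P3 / triple_denom_l c d P1 P2 P3,
           triple_num_r c d P1 P2 P3 / triple_denom_r c d P1 P2 P3)].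
Proof.
move=> C1 C2 C3; have [l0 r0] := edwards_denoms_neq0 hc hd C1 C2.
have [L0 R0] := edwards_denoms_neq0 hc hd (edwards_curve_add C1 C2) C3.
have lr0 := mulf_neq0 l0 r0.
have LE : triple_denom_l c d P1 P2 P3 = edwards_denom_l d (add P1 P2) P3
    * (edwards_denom_l d P1 P2 * edwards_denom_r d P1 P2).
  case: P1 P2 P3 {C1 C2 C3 L0 R0 lr0} l0 r0 => [x1 y1] [x2 y2] [x3 y3].
  rewrite /triple_denom_l /triple_corr /edwards_add.
  move: (edwards_denom_l _ (x1, y1) _) (edwards_denom_r _ _ _) => l r l0 r0.
  by rewrite /edwards_denom_l /=; field; rewrite l0 r0.
have RE : triple_denom_r c d P1 P2 P3 = edwards_denom_r d (add P1 P2) P3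
    * (edwards_denom_l d P1 P2 * edwards_denom_r d P1 P2).
  case: P1 P2 P3 {C1 C2 C3 L0 R0 lr0 LE} l0 r0 => [x1 y1] [x2 y2] [x3 y3].
  rewrite /triple_denom_r /triple_corr /edwards_add.
  move: (edwards_denom_l _ _ _) (edwards_denom_r _ (x1, y1) _) => l r l0 r0.
  by rewrite /edwards_denom_r /=; field; rewrite l0 r0.
rewrite LE RE !mulf_neq0 //; split=> //.
case: P1 P2 P3 {C1 C2 C3 lr0 LE RE} l0 r0 L0 R0 => [x1 y1] [x2 y2] [x3 y3].
rewrite /triple_num_l /triple_num_r /edwards_add.
move: (edwards_denom_l d (x1, y1) _) (edwards_denom_r d (x1, y1) _) => l r.
move: (edwards_denom_l _ _ _) (edwards_denom_r _ _ _) => L R l0 r0 L0 R0 /=.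
by congr (_, _); field; rewrite ?l0 ?r0 ?L0 ?R0.
Qed.

Lemma edwards_addA P1 P2 P3 :
  on_curve P1 -> on_curve P2 -> on_curve P3 ->
  add P1 (add P2 P3) = add (add P1 P2) P3.
Proof.
move=> C1 C2 C3; rewrite [LHS]edwards_addC.
have [L0 R0 ->] := edwards_add3E C1 C2 C3.
have [L0' R0' ->] := edwards_add3E C2 C3 C1.
have [El Er] := assoc_identity hd C1 C2 C3.
by congr (_, _); apply/eqP; rewrite eqr_div // ?El ?Er.
Qed.

End GroupLaw.

HB.instance Definition _ (k : fieldType) (c d : k) :=
  Choice.copy (edwards_point c d) {P : k * k | edwards_curve c d P}.

Theorem theorem1 (k : fieldType) (c d : k)
    (hc : is_square c) (hd : ~ is_nonzero_square d) :
  (forall P1 P2 : k * k,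
     edwards_curve c d P1 -> edwards_curve c d P2 ->
     [/\ edwards_denom_l d P1 P2 != 0,
         edwards_denom_r d P1 P2 != 0 &
         edwards_curve c d (edwards_add c d P1 P2)]) /\
  (exists cls : GRing.Zmodule (edwards_point c d),
     let C : zmodType := GRing.Zmodule.Pack cls in
     [/\ forall P1 P2 : C, sval (P1 + P2) = edwards_add c d (sval P1) (sval P2),
         sval (0 : C) = (1, 0) &
         forall P : C, sval (- P) = edwards_opp (sval P)]).
Proof.
split=> [P1 P2 C1 C2|].
  have [l0 r0] := edwards_denoms_neq0 hc hd C1 C2.
  by split=> //; exact: edwards_curve_add.
pose zero : edwards_point c d := exist (edwards_curve c d) _ (edwards_curve_one c d).
pose opp (P : edwards_point c d) : edwards_point c d :=
  exist (edwards_curve c d) _ (edwards_curve_opp (svalP P)).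
pose add (P Q : edwards_point c d) : edwards_point c d :=
  exist (edwards_curve c d) _ (edwards_curve_add hc hd (svalP P) (svalP Q)).
have addA : associative add.
  by move=> P Q R; apply: val_inj;
  exact: edwards_addA (svalP P) (svalP Q) (svalP R).
have addC : commutative add.
  by move=> P Q; apply: val_inj; exact: edwards_addC.
have add0 : left_id zero add.
  by move=> P; apply: val_inj; exact: edwards_add1.
have addN : left_inverse zero opp add.
  by move=> P; apply: val_inj; exact: edwards_addN (svalP P).
pose mixin := GRing.isZmodule.Build (edwards_point c d) addA addC add0 addN.
pose C : zmodType := HB.pack (edwards_point c d) mixin.
by exists (GRing.Zmodule.class C); split.
Qed.
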